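(* Let $r_1=\frac14\sqrt{7-3\sqrt5}=\frac18(3\sqrt2-\sqrt{10})$ and $r_2=-\frac14\sqrt{7+3\sqrt5}=-\frac18(3\sqrt2+\sqrt{10})$. Let $\mathfrak{g}_{r_1,r_2}$ be the $4$-dimensional real solvable Lie algebra with basis $(e_1,e_2,e_3,e_4)$ whose only non-zero brackets (up to antisymmetry) are $$[e_2,e_1]=r_1 e_2,\quad [e_3,e_1]=r_2 e_3,\quad [e_4,e_1]=(r_1+r_2)e_4,\quad [e_3,e_2]=e_4 .$$ Let $G$ be a simply-connected $4$-dimensional Lie group with Lie algebra $\mathfrak{g}_{r_1,r_2}$, let $(e^i)$ be the left-invariant $1$-forms on $G$ dual to $(e_i)$, and let $h=\sum_{i=1}^4 e^i\otimes e^i$. Then the left-invariant Riemannian metric $h$ is non-trivially Bach-flat; that is, the Bach tensor of $h$ is zero, the conformal class $[h]$ contains no Einstein metric, and $h$ is not half conformally flat (neither $W_+=0$ nor $W_-=0$).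
   Context: Equivalently, with $de^i(e_j,e_k)=-e^i([e_j,e_k])$, the Lie algebra is encoded by $de^1=0$, $de^2=r_1e^1\wedge e^2$, $de^3=r_2e^1\wedge e^3$, $de^4=(r_1+r_2)e^1\wedge e^4+e^2\wedge e^3$. For an oriented Riemannian $4$-manifold $(M,g)$, the Weyl tensor decomposes as $W=W_++W_-$ into its self-dual and anti-self-dual parts; $g$ is half conformally flat if $W_+=0$ or $W_-=0$. The conformal class $[g]$ is the set of metrics $e^{2f}g$ with $f$ a smooth function on $M$; $g$ is conformally Einstein if $[g]$ contains an Einstein metric. The Bach tensor $B$ is the conformally invariant, trace-free symmetric $2$-tensor which (up to a constant factor) is, for compact $M$, the gradient of $g\mapsto\int_M\|W[g]\|^2\,d\upsilon_g$. For a left-invariant metric on a $4$-dimensional Lie group (whose scalar curvature is constant), it is given in an orthonormal frame $(e_i)$ by $$B_{ij}=\sum_{p}\nabla_p\nabla_j\rho_{ip}-\tfrac12\sum_{p}\nabla_p\nabla_p\rho_{ij}+\tfrac13\tau\rho_{ij}-\sum_p\rho_{pi}\rho_{pj}+\tfrac1{12}\Big[3\sum_{r,s}(\rho_{rs})^2-\tau^2\Big]\delta_{ij},$$ where $\nabla$ is the Levi-Civita connection (and $\nabla_p\nabla_q$ denotes components of the second covariant derivative), $\rho$ the Ricci tensor and $\tau$ the scalar curvature. A metric is Bach-flat if $B=0$. It is non-trivially Bach-flat if it is Bach-flat but neither conformally Einstein nor half conformally flat. *)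

(* Defs.v *)
From HB Require Import structures.
From mathcomp Require Import all_boot all_order all_algebra monoid.
From mathcomp Require Import all_classical all_reals all_analysis.
Set Implicit Arguments.
Unset Strict Implicit.
Unset Printing Implicit Defensive.
Import Order.TTheory GRing.Theory Num.Theory.
Import numFieldNormedType.Exports.
Local Open Scope classical_set_scope.
Local Open Scope ring_scope.

#[short(type="topGroupType")]
HB.structure Definition TopGroup := {G of Topological G & Group G}.

Section Smoothness.
Context {R : realType}.

Definition iter_derive (V W : normedModType R) (vs : seq V) (f : V -> W) :
    V -> W :=
  foldr (fun v g => fun x => 'D_v g x) f vs.

(* f is C^infinity on the open set U: its iterated directional derivatives of
   all orders exist and are continuous at every point of U. *)
Definition smooth_on (V W : normedModType R) (U : set V) (f : V -> W) : Prop :=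
  forall (vs : seq V) (x : V), U x ->
    {for x, continuous (iter_derive vs f)} /\
    (forall v : V, derivable (iter_derive vs f) x v).

Record chart (n : nat) (M : topologicalType) := Chart {
  chart_dom : set M ;
  chart_map :> M -> 'rV[R]_n ;
  chart_inv : 'rV[R]_n -> M ;
  chart_dom_open : open chart_dom ;
  chart_img_open : open (chart_map @` chart_dom) ;
  chart_mapK : forall p, chart_dom p -> chart_inv (chart_map p) = p ;
  chart_map_cont : {within chart_dom, continuous chart_map} ;
  chart_inv_cont : {within chart_map @` chart_dom, continuous chart_inv}
}.

Variable n : nat.

Definition is_manifold (M : topologicalType) (A : set (chart n M)) : Prop :=
  [/\ hausdorff_space M,
      @second_countable M,
      forall p : M, exists2 a, A a & chart_dom a p &
      forall a b, A a -> A b ->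
        smooth_on (a @` (chart_dom a `&` chart_dom b)) (b \o chart_inv a)].

Definition smooth_fun (M : topologicalType) (A : set (chart n M))
    (f : M -> R) : Prop :=
  forall a, A a ->
    smooth_on (a @` chart_dom a) (f \o chart_inv a : 'rV[R]_n -> R).

Definition smooth_map (M : topologicalType) (A : set (chart n M))
    (F : M -> M) : Prop :=
  continuous F /\
  forall a b, A a -> A b ->
    smooth_on (a @` (chart_dom a `&` F @^-1` chart_dom b))
              (b \o F \o chart_inv a).

(* smoothness of a map M x M -> M, read in product charts of M x M *)
Definition smooth_map2 (M : topologicalType) (A : set (chart n M))
    (F : M -> M -> M) : Prop :=
  continuous (fun z : M * M => F z.1 z.2) /\
  forall a b c, A a -> A b -> A c ->
    smooth_on
      [set (a z.1, b z.2) | z in [set z : M * M |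
         [/\ chart_dom a z.1, chart_dom b z.2 & chart_dom c (F z.1 z.2)]]]
      (fun w : 'rV[R]_n * 'rV[R]_n => c (F (chart_inv a w.1) (chart_inv b w.2))).

Definition is_lie_group (G : topGroupType) (A : set (chart n G)) : Prop :=
  [/\ is_manifold A,
      smooth_map2 A (fun x y : G => (x * y)%g) &
      smooth_map A (fun x : G => (x^-1)%g)].

(* A vector field is represented by its action on smooth functions (its values
   on other functions are irrelevant): at each point, read in a chart, it is a
   directional derivative, and it sends smooth functions to smooth functions. *)
Definition vector_field (M : topologicalType) (A : set (chart n M))
    (X : (M -> R) -> M -> R) : Prop :=
  (forall f, smooth_fun A f -> smooth_fun A (X f)) /\
  (forall a p, A a -> chart_dom a p ->
     exists v : 'rV[R]_n, forall f, smooth_fun A f ->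
       X f p = 'D_v (f \o chart_inv a : 'rV[R]_n -> R) (a p)).

(* (dL_a X) f = (X (f \o L_a)) \o L_(a^-1) *)
Definition left_invariant_field (G : topGroupType) (A : set (chart n G))
    (X : (G -> R) -> G -> R) : Prop :=
  vector_field A X /\
  forall (a : G) f, smooth_fun A f ->
    forall x : G, X (fun y => f (a * y)%g) x = X f (a * x)%g.

Definition lie_algebra_basis (G : topGroupType) (A : set (chart n G))
    (E : 'I_n -> (G -> R) -> G -> R) : Prop :=
  (forall i, left_invariant_field A (E i)) /\
  (forall X, left_invariant_field A X ->
     exists! a : 'rV[R]_n, forall f, smooth_fun A f ->
       forall x, X f x = \sum_i a 0 i * E i f x).

(* [E_i, E_j] = \sum_k (c i j k) E_k, the bracket being the commutator of
   derivations *)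
Definition structure_constants (M : topologicalType) (A : set (chart n M))
    (E : 'I_n -> (M -> R) -> M -> R) (c : 'I_n -> 'I_n -> 'I_n -> R) : Prop :=
  forall i j f, smooth_fun A f -> forall x,
    E i (E j f) x - E j (E i f) x = \sum_k c i j k * E k f x.

Definition simply_connected (M : topologicalType) : Prop :=
  (forall x y : M, exists gam : R -> M,
     [/\ {within `[0, 1], continuous gam}, gam 0 = x & gam 1 = y]) /\
  (forall gam : R -> M,
     {within `[0, 1], continuous gam} -> gam 0 = gam 1 ->
     exists H : R * R -> M,
       [/\ {within (`[0, 1]%classic `*` `[0, 1]%classic), continuous H},
           forall t, `[0, 1]%classic t -> H (0, t) = gam t,
           forall t, `[0, 1]%classic t -> H (1, t) = gam 0 &
           forall s, `[0, 1]%classic s -> H (s, 0) = gam 0 /\ H (s, 1) = gam 0]).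

End Smoothness.

(* Riemannian geometry in a global frame E with constant structure coefficients
   c: [E_i, E_j] = \sum_k (c i j k) E_k. A metric g is given by its Gram
   matrices in the frame, g x i j = g(E_i, E_j)(x). Vector fields are given by
   their components in the frame, covariant tensors by their values on it. *)
Section FrameGeometry.
Context {R : realType} {M : Type} {n : nat}.
Variables (E : 'I_n -> (M -> R) -> M -> R) (c : 'I_n -> 'I_n -> 'I_n -> R).
Variable g : M -> 'M[R]_n.

(* g(nabla_{E_i} E_j, E_k), by the Koszul formula *)
Definition koszul (i j k : 'I_n) (x : M) : R :=
  2^-1 * (E i (fun y => g y j k) x + E j (fun y => g y i k) x
          - E k (fun y => g y i j) x
          + \sum_l c i j l * g x l k
          - \sum_l c i k l * g x l j
          - \sum_l c j k l * g x l i).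

(* nabla_{E_i} E_j = \sum_k (christoffel i j k) E_k *)
Definition christoffel (i j k : 'I_n) (x : M) : R :=
  \sum_l koszul i j l x * invmx (g x) l k.

(* nabla_{E_i} Y *)
Definition cov_deriv (i : 'I_n) (Y : M -> 'rV[R]_n) (x : M) : 'rV[R]_n :=
  \row_k (E i (fun y => Y y 0 k) x + \sum_j Y x 0 j * christoffel i j k x).

Definition frame_field (k : 'I_n) (x : M) : 'rV[R]_n := delta_mx 0 k.

(* R(E_i, E_j) E_k, with
   R(X, Y) = nabla_X nabla_Y - nabla_Y nabla_X - nabla_[X, Y] *)
Definition curvature (i j k : 'I_n) (x : M) : 'rV[R]_n :=
  cov_deriv i (cov_deriv j (frame_field k)) x
  - cov_deriv j (cov_deriv i (frame_field k)) x
  - \sum_l c i j l *: cov_deriv l (frame_field k) x.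

(* g(R(E_i, E_j) E_k, E_l); sectional curvatures are the components ijji *)
Definition riemann (i j k l : 'I_n) (x : M) : R :=
  \sum_m curvature i j k x 0 m * g x m l.

(* trace of X |-> R(X, E_j) E_k *)
Definition ricci (j k : 'I_n) (x : M) : R :=
  \sum_i curvature i j k x 0 i.

Definition scalar_curv (x : M) : R :=
  \sum_i \sum_j invmx (g x) i j * ricci i j x.

Definition einstein : Prop :=
  exists lam : R, forall x i j, ricci i j x = lam * g x i j.

(* (nabla_{E_k} T)(E_i, E_j) *)
Definition cov_deriv2 (T : 'I_n -> 'I_n -> M -> R) (k i j : 'I_n) (x : M) : R :=
  E k (T i j) x - \sum_l christoffel k i l x * T l j x
                - \sum_l christoffel k j l x * T i l x.

(* (nabla_{E_p} S)(E_k, E_i, E_j) *)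
Definition cov_deriv3 (S : 'I_n -> 'I_n -> 'I_n -> M -> R)
    (p k i j : 'I_n) (x : M) : R :=
  E p (S k i j) x - \sum_l christoffel p k l x * S l i j x
                  - \sum_l christoffel p i l x * S k l j x
                  - \sum_l christoffel p j l x * S k i l x.

(* nabla_p nabla_q rho_{ij}: the derivative along E_p is the outer one *)
Definition cov2_ricci (p q i j : 'I_n) (x : M) : R :=
  cov_deriv3 (cov_deriv2 ricci) p q i j x.

End FrameGeometry.

Definition conformal_metric {R : realType} {M : Type} {n : nat}
    (f : M -> R) (g : M -> 'M[R]_n) : M -> 'M[R]_n :=
  fun x => expR (2 * f x) *: g x.

Definition conformally_einstein {R : realType} {M : topologicalType} {n : nat}
    (A : set (chart (R := R) n M)) (E : 'I_n -> (M -> R) -> M -> R)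
    (c : 'I_n -> 'I_n -> 'I_n -> R) (g : M -> 'M[R]_n) : Prop :=
  exists2 f : M -> R, smooth_fun A f & einstein E c (conformal_metric f g).

Section DimensionFour.
Context {R : realType} {M : Type}.
Variables (E : 'I_4 -> (M -> R) -> M -> R) (c : 'I_4 -> 'I_4 -> 'I_4 -> R).

Section Weyl.
Variable g : M -> 'M[R]_4.
Local Notation rho := (ricci E c g).
Local Notation tau := (scalar_curv E c g).

Definition weyl (i j k l : 'I_4) (x : M) : R :=
  riemann E c g i j k l x
  - 2^-1 * (rho j k x * g x i l + rho i l x * g x j k
            - rho i k x * g x j l - rho j l x * g x i k)
  + tau x / 6 * (g x j k * g x i l - g x i k * g x j l).

Definition levi_civita_symbol (i j k l : 'I_4) : R :=
  \det (\matrix_(a < 4, b < 4) (tnth [tuple i; j; k; l] a == b)%:R).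

(* Hodge star on 2-forms, for the orientation in which the frame is positive *)
Definition hodge_star (w : 'I_4 -> 'I_4 -> M -> R) (i j : 'I_4) (x : M) : R :=
  2^-1 * \sum_a \sum_b \sum_p \sum_q
    Num.sqrt (\det (g x)) * levi_civita_symbol i j a b
    * invmx (g x) a p * invmx (g x) b q * w p q x.

(* W_+ and W_-, obtained by composing W, seen as an endomorphism of the bundle
   of 2-forms, with the projections (1 +/- star)/2 *)
Definition weyl_plus (i j k l : 'I_4) (x : M) : R :=
  2^-1 * (weyl i j k l x + hodge_star (fun p q => weyl p q k l) i j x).

Definition weyl_minus (i j k l : 'I_4) (x : M) : R :=
  2^-1 * (weyl i j k l x - hodge_star (fun p q => weyl p q k l) i j x).

Definition half_conformally_flat : Prop :=
  (forall i j k l x, weyl_plus i j k l x = 0) \/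
  (forall i j k l x, weyl_minus i j k l x = 0).

End Weyl.

(* h = \sum_k e^k (x) e^k for the dual coframe (e^k): the Gram matrix of
   e^k (x) e^k in the frame is delta_mx k k *)
Definition frame_metric (x : M) : 'M[R]_4 := \sum_k delta_mx k k.

(* Bach tensor of the metric h for which the frame is orthonormal; this form of
   it is valid because h has constant scalar curvature *)
Definition bach (i j : 'I_4) (x : M) : R :=
  let rho := ricci E c frame_metric in
  let tau := scalar_curv E c frame_metric in
  let DDrho := cov2_ricci E c frame_metric in
  \sum_p DDrho p j i p x
  - 2^-1 * \sum_p DDrho p p i j x
  + 3^-1 * tau x * rho i j x
  - \sum_p rho p i x * rho p j x
  + 12^-1 * (3 * (\sum_r \sum_s rho r s x ^+ 2) - tau x ^+ 2) * (i == j)%:R.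

Definition bach_flat : Prop := forall i j x, bach i j x = 0.

End DimensionFour.

(* h is Bach-flat, not conformally Einstein, and not half conformally flat *)
Definition nontrivially_bach_flat {R : realType} {M : topologicalType}
    (A : set (chart (R := R) 4 M)) (E : 'I_4 -> (M -> R) -> M -> R)
    (c : 'I_4 -> 'I_4 -> 'I_4 -> R) : Prop :=
  [/\ bach_flat E c,
      ~ conformally_einstein A E c (@frame_metric R M) &
      ~ half_conformally_flat E c (@frame_metric R M)].

(* [e_i, e_j] = \sum_k (g_struct r1 r2 i j k) e_k; indices start at 0, so that
   e_1, e_2, e_3, e_4 are numbered 0, 1, 2, 3. *)
Definition g_struct_half {R : realType} (r1 r2 : R) (i j k : 'I_4) : R :=
  match val i, val j, val k with
  | 1%N, 0%N, 1%N => r1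
  | 2%N, 0%N, 2%N => r2
  | 3%N, 0%N, 3%N => r1 + r2
  | 2%N, 1%N, 3%N => 1
  | _, _, _ => 0
  end.

Definition g_struct {R : realType} (r1 r2 : R) (i j k : 'I_4) : R :=
  g_struct_half r1 r2 i j k - g_struct_half r1 r2 j i k.

(* Main.v *)
Require Import Defs.
From mathcomp Require Import all_boot all_order all_algebra monoid all_fingroup.
From mathcomp Require Import all_classical all_reals all_analysis.
From mathcomp Require Import ring lra.
Set Implicit Arguments.
Unset Strict Implicit.
Unset Printing Implicit Defensive.
Import Order.TTheory GRing.Theory Num.Theory.
Import numFieldNormedType.Exports.
Local Open Scope classical_set_scope.
Local Open Scope ring_scope.

(** The proof reduces to algebra in a frame, plus one integrability argument.

    Bach-flatness and the failure of half conformal flatness are statements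
    about a left-invariant metric in a left-invariant orthonormal frame, hence
    about constants: every frame derivative vanishes and the curvature is
    polynomial in [r1] and [r2].  The particular values of [r1] and [r2] enter
    only through [r1 * r2 = - 1/8] and [r1 ^+ 2 + r2 ^+ 2 = 7/8].
    - The Bach tensor is diagonal, and its diagonal entries lie in the ideal of
      polynomials generated by these two relations ([bach_flat_g_struct]).
    - [W_1414 = 1/4] while [W_2314 = (r1 + r2) / 2], so a vanishing [W_+] or
      [W_-] would force [(r1 + r2) ^+ 2 = 1/4], whereas the relations give 5/8
      ([not_half_conformally_flat_g_struct]).

    No metric [e^(2f) h] is Einstein as soon as [r1 != r2].  Put [u_i = E_i f].
    In dimension four the conformal change of the Ricci tensor
    ([ricci_conformal]) turns the Einstein equation into
      [E_i u_j = \sum_l G_ijl u_l + u_i u_j + (rho_i / 2 - psi) delta_ij]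
    with [G] the connection of [h], [rho_i] its Ricci curvatures and [psi] an
    unknown function ([conformal_einstein_hessian]).  This system is
    overdetermined.  Differentiating the off-diagonal equations once more and
    imposing [E_2, E_3] u_4 = - E_4 u_4 and [E_2, E_4] u_3 = 0 shows that the
    three functions [E_i u_i - u_i ^+ 2], for i = 2, 3, 4, coincide; the unknown
    [psi] cancels in their differences, which leaves two affine equations on
    [u_1].  These are compatible only if [r1 = r2]
    ([not_conformally_einstein_g_struct]).  They come from the equation
    Cotton + Weyl (grad f) = 0 satisfied by every conformally Einstein metric.

    The analytic input is that smooth functions form an algebra closed under
    the exponential, on which vector fields act as derivations obeying the chain
    rule for the exponential; [smooth_frame] isolates exactly this, and the
    geometry is done over it.  Smoothness is expressed by iterated directional
    derivatives, so closure under products and exponentials is proved by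
    induction on the order of differentiability. *)

(** * Functions with iterated directional derivatives up to a given order *)
Section SmoothUpTo.
Context {R : realType} {V : normedModType R}.
Implicit Types (U : set V) (f g : V -> R) (vs : seq V).

(** The order is bounded so that closure under the exponential can be proved by
    induction: the derivative of [expR \o f] is a product involving [expR \o f]
    itself, which is only known to be differentiable to one order less. *)
Definition smooth_upto (k : nat) U f : Prop :=
  forall vs, (size vs <= k)%N -> forall x, U x ->
    {for x, continuous (iter_derive vs f)} /\
    (forall v, derivable (iter_derive vs f) x v).

Lemma smooth_on_uptoP U f : smooth_on U f <-> forall k, smooth_upto k U f.
Proof.
split=> [sf k vs _ x Ux|sf vs x Ux]; first exact: sf.
exact: (sf (size vs)).
Qed.

Lemma near_open U (P : V -> Prop) x :
  open U -> U x -> (forall y, U y -> P y) -> \forall y \near x, P y.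
Proof.
by move=> oU Ux UP; near=> y; apply: UP; near: y; exact: open_nbhs_nbhs.
Unshelve. all: by end_near. Qed.

(** A directional derivative depends only on the germ of the function; openness
    of [U] carries this through the iteration. *)
Lemma iter_derive_eq_on U vs f g : open U -> (forall x, U x -> f x = g x) ->
  forall x, U x -> iter_derive vs f x = iter_derive vs g x.
Proof.
move=> oU fg; elim: vs => [|v vs IH] x Ux /=; first exact: fg.
by apply: near_eq_derive; exact: near_open Ux IH.
Qed.

Lemma smooth_upto_eq_on U k f g : open U -> (forall x, U x -> f x = g x) ->
  smooth_upto k U f -> smooth_upto k U g.
Proof.
move=> oU fg sf vs vsk x Ux; have [cf df] := sf vs vsk x Ux.
have e := iter_derive_eq_on vs oU fg.
have nfg : \forall y \near x, iter_derive vs f y = iter_derive vs g y.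
  exact: near_open Ux e.
split=> [|v]; last exact: near_eq_derivable nfg (df v).
rewrite /prop_for /continuous_at -e//.
by apply: cvg_trans cf; exact: near_eq_cvg.
Qed.

Lemma smooth_uptoW U j k f : (j <= k)%N -> smooth_upto k U f ->
  smooth_upto j U f.
Proof. by move=> jk sf vs vsj; apply: sf; exact: leq_trans jk. Qed.

(** [iter_derive] applies the first vector of the list last.  Induction on the
    order must instead differentiate [f] itself first, which peels off the last
    vector. *)
Lemma smooth_uptoSP U k f : smooth_upto k.+1 U f <->
  smooth_upto 0 U f /\ forall v, smooth_upto k U (fun x => 'D_v f x).
Proof.
split=> [sf|[f0 fD]].
  split=> [|v vs vsk]; first exact: smooth_uptoW sf.
  have := sf (rcons vs v); rewrite size_rcons ltnS => /(_ vsk).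
  by rewrite /iter_derive foldr_rcons.
elim/last_ind => [_|vs v _]; first exact: (f0 [::]).
rewrite size_rcons ltnS => vsk; have := fD v vs vsk.
by rewrite /iter_derive foldr_rcons.
Qed.

Lemma smooth_upto0P U f : smooth_upto 0 U f <->
  forall x, U x -> {for x, continuous f} /\ forall v, derivable f x v.
Proof. by split=> [sf|f0 [|//] _]; [exact: (sf [::] isT)|exact: f0]. Qed.

Lemma smooth_upto_derivable U k f x v : smooth_upto k U f -> U x ->
  derivable f x v.
Proof. by move=> sf Ux; have [] := sf [::] isT x Ux. Qed.

Lemma smooth_upto_cst U k (r : R) : smooth_upto k U (fun=> r).
Proof.
elim: k r => [|k IH] r.
  by apply/smooth_upto0P => x _; split=> [|v]; [exact: cvg_cst|exact: derivable_cst].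
apply/smooth_uptoSP; split=> [|v].
  by apply/smooth_upto0P => x _; split=> [|w]; [exact: cvg_cst|exact: derivable_cst].
suff -> : (fun x => 'D_v (fun=> r) x) = (fun=> 0) by exact: IH.
by apply/funext => x; rewrite derive_cst.
Qed.

Lemma smooth_uptoD U k f g : open U -> smooth_upto k U f -> smooth_upto k U g ->
  smooth_upto k U (fun x => f x + g x).
Proof.
move=> oU; elim: k f g => [|k IH] f g.
  move=> /smooth_upto0P sf /smooth_upto0P sg; apply/smooth_upto0P => x Ux.
  have [[cf df] [cg dg]] := (sf x Ux, sg x Ux).
  by split=> [|v]; [exact: cvgD|exact: derivableD].
move=> sf sg; have [f0 fD] := (smooth_uptoSP _ _ _).1 sf.
have [g0 gD] := (smooth_uptoSP _ _ _).1 sg.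
apply/smooth_uptoSP; split=> [|v].
  apply/smooth_upto0P => x Ux.
  have [[cf df] [cg dg]] := (f0 [::] isT x Ux, g0 [::] isT x Ux).
  by split=> [|v]; [exact: cvgD|exact: derivableD].
apply: smooth_upto_eq_on (IH _ _ (fD v) (gD v)) => // x Ux.
rewrite -[RHS]/('D_v (f + g) x) deriveD//.
  exact: smooth_upto_derivable sf Ux.
exact: smooth_upto_derivable sg Ux.
Qed.

Lemma smooth_uptoM U k f g : open U -> smooth_upto k U f -> smooth_upto k U g ->
  smooth_upto k U (fun x => f x * g x).
Proof.
move=> oU; have M0 f' g' : smooth_upto 0 U f' -> smooth_upto 0 U g' ->
    smooth_upto 0 U (fun x => f' x * g' x).
  move=> /smooth_upto0P sf /smooth_upto0P sg; apply/smooth_upto0P => x Ux.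
  have [[cf df] [cg dg]] := (sf x Ux, sg x Ux).
  by split=> [|v]; [exact: cvgM|exact: derivableM].
elim: k f g => [|k IH] f g; first exact: M0.
move=> sf sg; have [f0 fD] := (smooth_uptoSP _ _ _).1 sf.
have [g0 gD] := (smooth_uptoSP _ _ _).1 sg.
apply/smooth_uptoSP; split=> [|v]; first exact: M0.
have sfk := smooth_uptoW (leqnSn k) sf.
have sgk := smooth_uptoW (leqnSn k) sg.
apply: smooth_upto_eq_on
  (smooth_uptoD oU (IH _ _ sfk (gD v)) (IH _ _ sgk (fD v))) => // x Ux.
rewrite -[RHS]/('D_v (f * g) x) deriveM//.
  exact: smooth_upto_derivable sf Ux.
exact: smooth_upto_derivable sg Ux.
Qed.

(** A directional derivative is the derivative of a function of one variable,
    so the chain rule needs no differentiability of [f] beyond the direction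
    [v]. *)
Lemma derive_line f x v : 'D_v f x = 'D_1 (fun h : R => f (h *: v + x)) 0.
Proof.
rewrite /derive; set g1 := fun h => h^-1 *: _; set g2 := fun h => h^-1 *: _.
suff -> : g1 = g2 by [].
by rewrite funeqE /g1 /g2 => h /=; rewrite addr0 scale0r add0r [_%:A]mulr1.
Qed.

Lemma derive_expR_comp f x v : derivable f x v ->
  derivable (expR \o f) x v /\ 'D_v (expR \o f) x = expR (f x) * 'D_v f x.
Proof.
move=> df; pose l h := f (h *: v + x).
have dl : derivable l 0 1 := (derivable1P f x v).1 df.
have l0 : l 0 = f x by rewrite /l scale0r add0r.
have del : derivable expR (l 0) 1 by exact: derivable_expR.
split.
  apply: (derivable1P (expR \o f) x v).2; apply/derivable1_diffP.
  by apply: (@differentiable_comp _ _ _ _ l expR); exact/derivable1_diffP.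
have -> : 'D_v (expR \o f) x = 'D_1 (expR \o l) 0 by exact: derive_line.
have -> : 'D_v f x = 'D_1 l 0 by exact: derive_line.
by rewrite -!derive1E derive1_comp// l0 [in LHS]derive1E derive_val.
Qed.

Lemma smooth_upto_expR U k f : open U -> smooth_upto k U f ->
  smooth_upto k U (fun x => expR (f x)).
Proof.
move=> oU; have E0 f' : smooth_upto 0 U f' ->
    smooth_upto 0 U (fun x => expR (f' x)).
  move=> /smooth_upto0P sf; apply/smooth_upto0P => x Ux.
  have [cf df] := sf x Ux; split=> [|v]; last exact: (derive_expR_comp (df v)).1.
  exact: (continuous_comp cf (@continuous_expR R _)).
elim: k f => [|k IH] f; first exact: E0.
move=> sf; have [f0 fD] := (smooth_uptoSP _ _ _).1 sf.
apply/smooth_uptoSP; split=> [|v]; first exact: E0.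
have sfk := smooth_uptoW (leqnSn k) sf.
apply: smooth_upto_eq_on (smooth_uptoM oU (IH _ sfk) (fD v)) => // x Ux.
by rewrite -(derive_expR_comp (smooth_upto_derivable sf Ux)).2.
Qed.

End SmoothUpTo.

(** * Vector fields as derivations of the smooth functions *)
Section SmoothFun.
Context {R : realType} {n : nat} {M : topologicalType} {A : set (chart (R := R) n M)}.
Implicit Types f g : M -> R.

Lemma smooth_fun_cst (r : R) : smooth_fun A (fun=> r).
Proof. by move=> a Aa; apply/smooth_on_uptoP => k; exact: smooth_upto_cst. Qed.

Lemma smooth_funD f g : smooth_fun A f -> smooth_fun A g ->
  smooth_fun A (fun x => f x + g x).
Proof.
move=> sf sg a Aa; apply/smooth_on_uptoP => k.
apply: smooth_uptoD; first exact: chart_img_open.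
  by apply: (smooth_on_uptoP _ _).1; exact: sf.
by apply: (smooth_on_uptoP _ _).1; exact: sg.
Qed.

Lemma smooth_funM f g : smooth_fun A f -> smooth_fun A g ->
  smooth_fun A (fun x => f x * g x).
Proof.
move=> sf sg a Aa; apply/smooth_on_uptoP => k.
apply: smooth_uptoM; first exact: chart_img_open.
  by apply: (smooth_on_uptoP _ _).1; exact: sf.
by apply: (smooth_on_uptoP _ _).1; exact: sg.
Qed.

Lemma smooth_fun_expR f : smooth_fun A f -> smooth_fun A (fun x => expR (f x)).
Proof.
move=> sf a Aa; apply/smooth_on_uptoP => k.
apply: smooth_upto_expR; first exact: chart_img_open.
by apply: (smooth_on_uptoP _ _).1; exact: sf.
Qed.

Hypothesis coverA : forall p : M, exists2 a, A a & chart_dom a p.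
Variable X : (M -> R) -> M -> R.
Hypothesis vX : vector_field A X.

(** One tangent vector [v] serves all smooth functions at once: this is what
    turns the rules of calculus for ['D_v] into rules for [X]. *)
Lemma vector_field_local p : exists (a : chart n M) (v : 'rV[R]_n),
  [/\ A a, chart_dom a p & forall f, smooth_fun A f ->
    X f p = 'D_v (f \o chart_inv a : 'rV[R]_n -> R) (a p) /\
    derivable (f \o chart_inv a : 'rV[R]_n -> R) (a p) v].
Proof.
have [a Aa ap] := coverA p; have [v vE] := vX.2 a p Aa ap.
exists a, v; split=> // f sf; split; first exact: vE.
have aUp : (a @` chart_dom a) (a p) by exists p.
exact: (sf a Aa [::] (a p) aUp).2.
Qed.

Lemma vector_field_cst (r : R) p : X (fun=> r) p = 0.
Proof.
have [a [v [_ _ XE]]] := vector_field_local p.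
by rewrite (XE _ (smooth_fun_cst r)).1 derive_cst.
Qed.

Lemma vector_fieldD f g p : smooth_fun A f -> smooth_fun A g ->
  X (fun x => f x + g x) p = X f p + X g p.
Proof.
move=> sf sg; have [a [v [_ _ XE]]] := vector_field_local p.
rewrite (XE _ (smooth_funD sf sg)).1 (XE _ sf).1 (XE _ sg).1.
exact: deriveD (XE _ sf).2 (XE _ sg).2.
Qed.

Lemma vector_fieldM f g p : smooth_fun A f -> smooth_fun A g ->
  X (fun x => f x * g x) p = f p * X g p + g p * X f p.
Proof.
move=> sf sg; have [a [v [_ ap XE]]] := vector_field_local p.
rewrite (XE _ (smooth_funM sf sg)).1 (XE _ sf).1 (XE _ sg).1.
rewrite -[LHS]/('D_v ((f \o chart_inv a) * (g \o chart_inv a)) (a p)).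
by rewrite (deriveM (XE _ sf).2 (XE _ sg).2) /= chart_mapK.
Qed.

Lemma vector_field_expR f p : smooth_fun A f ->
  X (fun x => expR (f x)) p = expR (f p) * X f p.
Proof.
move=> sf; have [a [v [_ ap XE]]] := vector_field_local p.
rewrite (XE _ (smooth_fun_expR sf)).1 (XE _ sf).1.
rewrite -[LHS]/('D_v (expR \o (f \o chart_inv a)) (a p)).
by rewrite (derive_expR_comp (XE _ sf).2).2 /= chart_mapK.
Qed.

End SmoothFun.

(** * Curvature in a frame *)

(** The calculus that the curvature computations use, with no reference to
    charts: [S] plays the role of the algebra of smooth functions. *)
Record smooth_frame {R : realType} {M : Type} {n : nat}
    (S : set (M -> R)) (E : 'I_n -> (M -> R) -> M -> R) : Prop := SmoothFrame {
  smooth_cst : forall r, S (fun=> r);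
  smoothD : forall f g, S f -> S g -> S (fun x => f x + g x);
  smoothM : forall f g, S f -> S g -> S (fun x => f x * g x);
  smooth_expR : forall f, S f -> S (fun x => expR (f x));
  smoothE : forall i f, S f -> S (E i f);
  frame_cst : forall i r x, E i (fun=> r) x = 0;
  frameD : forall i f g x, S f -> S g ->
    E i (fun y => f y + g y) x = E i f x + E i g x;
  frameM : forall i f g x, S f -> S g ->
    E i (fun y => f y * g y) x = f x * E i g x + g x * E i f x;
  frame_expR : forall i f x, S f ->
    E i (fun y => expR (f y)) x = expR (f x) * E i f x }.

Section Curvature.
Context {R : realType} {M : Type} {n : nat}.
Variables (S : set (M -> R)) (E : 'I_n -> (M -> R) -> M -> R).
Hypothesis sE : smooth_frame S E.
Variable c : 'I_n -> 'I_n -> 'I_n -> R.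

Lemma sum_deltar (F : 'I_n -> R) i : \sum_j F j * (j == i)%:R = F i.
Proof.
rewrite (bigD1 i)//= eqxx mulr1 big1 ?addr0// => j /negPf ->.
by rewrite mulr0.
Qed.

Lemma cov_deriv_frame_field g i k y :
  cov_deriv E c g i (frame_field k) y = \row_m christoffel E c g i k m y.
Proof.
apply/rowP => m; rewrite !mxE (_ : (fun y0 : M => _) = fun=> (m == k)%:R).
  rewrite (frame_cst sE) add0r -[RHS](sum_deltar (fun l => christoffel E c g i l m y)).
  by apply: eq_bigr => l _; rewrite !mxE/= mulrC.
by apply/funext => z; rewrite !mxE.
Qed.

(** The usual formula with derivatives and products of Christoffel symbols,
    valid for any metric: the components of the frame fields are constant. *)
Lemma curvatureE g i j k x m : curvature E c g i j k x 0 m =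
  E i (christoffel E c g j k m) x - E j (christoffel E c g i k m) x
  + \sum_l (christoffel E c g j k l x * christoffel E c g i l m x
            - christoffel E c g i k l x * christoffel E c g j l m x)
  - \sum_l c i j l * christoffel E c g l k m x.
Proof.
have covE a b : cov_deriv E c g a (cov_deriv E c g b (frame_field k)) x 0 m =
    E a (christoffel E c g b k m) x
    + \sum_l christoffel E c g b k l x * christoffel E c g a l m x.
  rewrite !mxE; congr (E a _ x + _).
    by apply/funext => y; rewrite cov_deriv_frame_field mxE.
  by apply: eq_bigr => l _; rewrite cov_deriv_frame_field mxE.
have subE (a b d : 'rV[R]_n) : (a - b - d) 0 m = a 0 m - b 0 m - d 0 m.
  by rewrite !mxE.
rewrite /curvature subE !covE sumrB summxE.
under [X in _ - X = _]eq_bigr do rewrite mxE cov_deriv_frame_field mxE.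
by ring.
Qed.

(** The Christoffel symbols of the metric for which the frame is orthonormal:
    the Koszul formula without its derivative terms. *)
Definition levi_civita_conn (i j k : 'I_n) : R :=
  2^-1 * (c i j k - c i k j - c j k i).

(** The derivatives of the conformal factor [expR (2 * f)] produce the three
    terms in [E f]; the bracket terms are only rescaled. *)
Lemma conformal_koszul f i j k x : S f ->
  koszul E c (fun y => expR (2 * f y) *: 1%:M) i j k x =
  expR (2 * f x) * (levi_civita_conn i j k + E i f x * (j == k)%:R
    + E j f x * (i == k)%:R - E k f x * (i == j)%:R).
Proof.
move=> sf; have s2 := smooth_cst sE 2.
have s2f := smoothM sE s2 sf.
have dg a (p q : 'I_n) : E a (fun y => (expR (2 * f y) *: 1%:M : 'M[R]_n) p q) x =
    expR (2 * f x) * (2 * E a f x) * (p == q)%:R.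
  rewrite (_ : (fun y => _) = fun y => expR (2 * f y) * (p == q)%:R); last first.
    by apply/funext => y; rewrite !mxE.
  rewrite (frameM sE)//; [|exact: (smooth_expR sE)|exact: (smooth_cst sE)].
  rewrite (frame_cst sE) (frame_expR sE)// (frameM sE)// (frame_cst sE).
  by ring.
have sg (F : 'I_n -> R) p :
    \sum_l F l * (expR (2 * f x) *: 1%:M : 'M[R]_n) l p = expR (2 * f x) * F p.
  rewrite -[F p in RHS]sum_deltar big_distrr; apply: eq_bigr => l _ /=.
  by rewrite !mxE mulrCA.
by rewrite /koszul !dg !sg /levi_civita_conn; field.
Qed.

Lemma conformal_christoffel f i j k x : S f ->
  christoffel E c (fun y => expR (2 * f y) *: 1%:M) i j k x =
  levi_civita_conn i j k + E i f x * (j == k)%:R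
    + E j f x * (i == k)%:R - E k f x * (i == j)%:R.
Proof.
move=> sf; have e0 : expR (2 * f x) != 0 by rewrite gt_eqF ?expR_gt0.
have invg : invmx (expR (2 * f x) *: 1%:M : 'M[R]_n) = (expR (2 * f x))^-1 *: 1%:M.
  by rewrite !scalemx1 invmx_scalar.
rewrite /christoffel invg.
under eq_bigr do rewrite conformal_koszul// !mxE mulrA.
rewrite sum_deltar.
by field.
Qed.

End Curvature.

(** * Conformal change of the Ricci tensor in dimension four *)
Definition e1 : 'I_4 := @Ordinal 4 0 isT.
Definition e2 : 'I_4 := @Ordinal 4 1 isT.
Definition e3 : 'I_4 := @Ordinal 4 2 isT.
Definition e4 : 'I_4 := @Ordinal 4 3 isT.

Lemma sum_ord4 (V : nmodType) (F : 'I_4 -> V) :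
  \sum_i F i = F e1 + F e2 + F e3 + F e4.
Proof.
by rewrite !big_ord_recr big_ord0 /= add0r; do !congr (_ + _);
   congr F; exact: val_inj.
Qed.

Lemma ord4_ind (P : 'I_4 -> Prop) : P e1 -> P e2 -> P e3 -> P e4 ->
  forall i, P i.
Proof.
move=> P1 P2 P3 P4 [[|[|[|[|//]]]] lti].
- by rewrite (_ : Ordinal lti = e1)//; exact: val_inj.
- by rewrite (_ : Ordinal lti = e2)//; exact: val_inj.
- by rewrite (_ : Ordinal lti = e3)//; exact: val_inj.
- by rewrite (_ : Ordinal lti = e4)//; exact: val_inj.
Qed.

(** The algebraic content of the conformal change formula, at one point: [G]
    stands for the connection of [h], [u] for the differential of [f] in the
    frame and [H i j] for [E i (E j f)]. *)
Section ConformalRicci.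
Context {R : realType}.
Variables (G c : 'I_4 -> 'I_4 -> 'I_4 -> R) (u : 'I_4 -> R) (H : 'I_4 -> 'I_4 -> R).
Hypothesis GN : forall i j k, G i j k = - G i k j.
Hypothesis cG : forall i j k, c i j k = G i j k - G j i k.
Hypothesis HN : forall i j, H i j = H j i + \sum_l c i j l * u l.

(** The Ricci tensor of a connection with Christoffel symbols [C], whose frame
    derivatives [E a (C i j k)] are given by [dC a i j k]. *)
Definition ricci_of (C : 'I_4 -> 'I_4 -> 'I_4 -> R)
  (dC : 'I_4 -> 'I_4 -> 'I_4 -> 'I_4 -> R) j k : R :=
  \sum_i (dC i j k i - dC j i k i + \sum_l (C j k l * C i l i - C i k l * C j l i)
    - \sum_l c i j l * C l k i).

Local Notation d i j := ((i == j)%:R : R).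

(** The classical formula Ric' = Ric - 2 (Hess f - df df) - (...) h.  It is a
    polynomial identity in the independent components of [G], [u] and [H], once
    the antisymmetry of [G], the absence of torsion and the symmetry of the
    Hessian have eliminated the others. *)
Lemma ricci_conformal_change j k :
  ricci_of (fun i j k => G i j k + u i * d j k + u j * d i k - u k * d i j)
    (fun a i j k => H a i * d j k + H a j * d i k - H a k * d i j) j k =
  ricci_of G (fun _ _ _ _ => 0) j k
  - 2 * (H j k - \sum_l G j k l * u l - u j * u k)
  - (\sum_i (H i i - \sum_l G i i l * u l + 2 * u i ^+ 2)) * d j k.
Proof.
have G0 i p : G i p p = 0 by have := GN i p p; lra.
have G21 i : G i e2 e1 = - G i e1 e2 by exact: GN.
have G31 i : G i e3 e1 = - G i e1 e3 by exact: GN.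
have G41 i : G i e4 e1 = - G i e1 e4 by exact: GN.
have G32 i : G i e3 e2 = - G i e2 e3 by exact: GN.
have G42 i : G i e4 e2 = - G i e2 e4 by exact: GN.
have G43 i : G i e4 e3 = - G i e3 e4 by exact: GN.
have H21 := HN e2 e1; have H31 := HN e3 e1; have H41 := HN e4 e1.
have H32 := HN e3 e2; have H42 := HN e4 e2; have H43 := HN e4 e3.
rewrite /ricci_of.
elim/ord4_ind: k; elim/ord4_ind: j; rewrite !sum_ord4 !eqxx /=.
all: rewrite ?(H21, H31, H41, H32, H42, H43) ?sum_ord4 !cG !G0.
all: rewrite !(G21, G31, G41, G32, G42, G43).
all: ring.
Qed.
End ConformalRicci.

(** * The orthonormal frame metric and its conformal class *)
Section FourFrame.
Context {R : realType} {M : Type}.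
Variables (S : set (M -> R)) (E : 'I_4 -> (M -> R) -> M -> R).
Hypothesis sE : smooth_frame S E.
Variable c : 'I_4 -> 'I_4 -> 'I_4 -> R.
Hypothesis cN : forall i j k, c i j k = - c j i k.
Hypothesis Ebr : forall i j f, S f -> forall x,
  E i (E j f) x - E j (E i f) x = \sum_k c i j k * E k f x.
Local Notation h := (@frame_metric R M).
Local Notation G := (levi_civita_conn c).
Local Notation d i j := ((i == j)%:R : R).

Lemma frame_metricE x : h x = 1%:M.
Proof. by rewrite /frame_metric -mx1_sum_delta. Qed.

Lemma levi_civita_connN i j k : G i j k = - G i k j.
Proof. by rewrite /levi_civita_conn (cN j k) (cN k j i) (cN j k i); field. Qed.

Lemma levi_civita_conn_torsion i j k : c i j k = G i j k - G j i k.
Proof. by rewrite /levi_civita_conn (cN j i k) ; field. Qed.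

(** This is the conformal formula for the factor 1, that is, for [f = 0]. *)
Lemma christoffel_frame i j k x : christoffel E c h i j k x = G i j k.
Proof.
rewrite (_ : h = fun y => expR (2 * (fun=> 0) y) *: 1%:M).
  rewrite (conformal_christoffel sE); last exact: (smooth_cst sE).
  by rewrite !(frame_cst sE) !mul0r !addr0 subr0.
by apply/funext => y; rewrite mulr0 expR0 scale1r frame_metricE.
Qed.

Lemma curvature_frame i j k x m : curvature E c h i j k x 0 m =
  \sum_l (G j k l * G i l m - G i k l * G j l m) - \sum_l c i j l * G l k m.
Proof.
have E0 a p q r : E a (christoffel E c h p q r) x = 0.
  rewrite (_ : christoffel E c h p q r = fun=> G p q r) ?(frame_cst sE)//.
  by apply/funext => y; exact: christoffel_frame.
rewrite (curvatureE sE) !E0 subrr add0r.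
by congr (_ - _); apply: eq_bigr => l _; rewrite !christoffel_frame.
Qed.

Lemma ricci_frame j k x :
  ricci E c h j k x = ricci_of c G (fun _ _ _ _ => 0) j k.
Proof.
by apply: eq_bigr => i _; rewrite curvature_frame subrr add0r.
Qed.

Lemma ricci_conformal f j k x : S f ->
  ricci E c (conformal_metric f h) j k x =
  ricci E c h j k x
  - 2 * (E j (E k f) x - \sum_l G j k l * E l f x - E j f x * E k f x)
  - (\sum_i (E i (E i f) x - \sum_l G i i l * E l f x + 2 * E i f x ^+ 2))
    * d j k.
Proof.
move=> sf; rewrite ricci_frame.
rewrite (_ : conformal_metric f h = fun y => expR (2 * f y) *: 1%:M); last first.
  by apply/funext => y; rewrite /conformal_metric frame_metricE.
rewrite -(@ricci_conformal_change _ G c (fun i => E i f x) (fun i j => E i (E j f) x)).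
- apply: eq_bigr => i _; rewrite (curvatureE sE).
  have dC a p q r : E a (christoffel E c (fun y => expR (2 * f y) *: 1%:M) p q r) x =
      E a (E p f) x * d q r + E a (E q f) x * d p r - E a (E r f) x * d p q.
    rewrite (_ : christoffel _ _ _ _ _ _ = fun y => G p q r + E p f y * d q r
      + E q f y * d p r + E r f y * (- d p q)); last first.
      by apply/funext => y; rewrite (conformal_christoffel sE)// mulrN.
    have sc := smooth_cst sE; have sD := smoothD sE; have sM := smoothM sE.
    have sEf i0 := smoothE sE i0 sf.
    rewrite (frameD sE) ?(frameD sE) ?(frameM sE) ?(frame_cst sE) //.
    all: try by repeat first
      [exact: sc|exact: sEf|refine (sM _ _ _ _)|refine (sD _ _ _ _)].
    by ring.
  rewrite !dC; congr (_ + _ - _); apply: eq_bigr => l _;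
    by rewrite !(conformal_christoffel sE).
- exact: levi_civita_connN.
- exact: levi_civita_conn_torsion.
- by move=> i' j'; rewrite -Ebr// addrC subrK.
Qed.

End FourFrame.

(** * Curvature of the Lie algebra *)
Section Tables.
Context {R : realType}.
Variables r1 r2 : R.
Local Notation c := (g_struct r1 r2).

Lemma g_structN i j k : c i j k = - c j i k.
Proof. by rewrite /g_struct opprB. Qed.

Definition g_conn (i j k : 'I_4) : R :=
  match val i, val j, val k with
  | 1%N, 0%N, 1%N => r1 | 1%N, 1%N, 0%N => - r1
  | 2%N, 0%N, 2%N => r2 | 2%N, 2%N, 0%N => - r2
  | 3%N, 0%N, 3%N => r1 + r2 | 3%N, 3%N, 0%N => - (r1 + r2)
  | 1%N, 2%N, 3%N | 2%N, 3%N, 1%N | 3%N, 2%N, 1%N => - 2^-1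
  | 1%N, 3%N, 2%N | 2%N, 1%N, 3%N | 3%N, 1%N, 2%N => 2^-1
  | _, _, _ => 0
  end.

Lemma levi_civita_conn_g_struct : levi_civita_conn c = g_conn.
Proof.
apply/funext => i; apply/funext => j; apply/funext => k.
rewrite /levi_civita_conn /g_struct /g_struct_half /g_conn.
by elim/ord4_ind: i; elim/ord4_ind: j; elim/ord4_ind: k => /=; field.
Qed.

(** The Ricci tensor is diagonal in the frame; these are its eigenvalues. *)
Definition g_ricci (i : 'I_4) : R :=
  match val i with
  | 0%N => - (r1 ^+ 2 + r2 ^+ 2 + (r1 + r2) ^+ 2)
  | 1%N => - 2 * r1 * (r1 + r2) - 2^-1
  | 2%N => - 2 * r2 * (r1 + r2) - 2^-1
  | _ => - 2 * (r1 + r2) ^+ 2 + 2^-1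
  end.

Lemma ricci_of_g_conn j k :
  ricci_of c g_conn (fun _ _ _ _ => 0) j k = g_ricci j * (j == k)%:R.
Proof.
rewrite /ricci_of /g_ricci /g_struct.
elim/ord4_ind: j; elim/ord4_ind: k;
  by rewrite !sum_ord4 /g_conn /g_struct_half /=; field.
Qed.

End Tables.

(** * The metric is not conformally Einstein *)
Section Obstruction.
Context {R : realType} {M : Type}.
Variables (S : set (M -> R)) (E : 'I_4 -> (M -> R) -> M -> R).
Hypothesis sE : smooth_frame S E.
Variables r1 r2 : R.
Local Notation c := (g_struct r1 r2).
Hypothesis Ebr : forall i j f, S f -> forall x,
  E i (E j f) x - E j (E i f) x = \sum_k c i j k * E k f x.
Local Notation h := (@frame_metric R M).

Lemma ricci_g_struct i j x : ricci E c h i j x = g_ricci r1 r2 i * (i == j)%:R.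
Proof.
by rewrite (ricci_frame sE) levi_civita_conn_g_struct ricci_of_g_conn.
Qed.

(** In dimension four the conformal change formula determines the trace-free
    part of Hess f - df df; what it leaves undetermined, together with the
    Einstein constant, is gathered in [psi]. *)
Lemma conformal_einstein_hessian f : S f ->
  einstein E c (conformal_metric f h) ->
  exists psi : M -> R, forall i j x, E i (E j f) x =
    \sum_l g_conn r1 r2 i j l * E l f x + E i f x * E j f x
    + (2^-1 * g_ricci r1 r2 i - psi x) * (i == j)%:R.
Proof.
move=> sf [lam ein].
exists (fun x => 2^-1 * (\sum_i (E i (E i f) x
    - \sum_l g_conn r1 r2 i i l * E l f x + 2 * E i f x ^+ 2)
  + lam * expR (2 * f x))) => i j x.
have := ein x i j.
rewrite (ricci_conformal sE (g_structN r1 r2) Ebr)// ricci_g_struct.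
rewrite levi_civita_conn_g_struct.
rewrite /conformal_metric !mxE frame_metricE mxE.
set s := \sum_l g_conn r1 r2 i j l * _; set t := \sum_i0 (_ + _) => e.
have -> : E i (E j f) x = s + E i f x * E j f x + 2^-1 * (g_ricci r1 r2 i * (i == j)%:R
   - t * (i == j)%:R - lam * (expR (2 * f x) * (i == j)%:R)) by rewrite -e; field.
by field.
Qed.

(** The integrability conditions of the Hessian equations.  Frame derivatives of
    [psi] never occur, because [psi] enters only the diagonal equations and
    those are not differentiated. *)
Lemma not_conformally_einstein_g_struct f (x : M) : r1 != r2 -> S f ->
  ~ einstein E c (conformal_metric f h).
Proof.
move=> r12 sf /(conformal_einstein_hessian sf)[psi hess].
pose u i := E i f.
have su i : S (u i) by exact: (smoothE sE i sf).
have uE i j : E i (u j) = fun y => \sum_l g_conn r1 r2 i j l * u l y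
    + u i y * u j y + (2^-1 * g_ricci r1 r2 i - psi y) * (i == j)%:R.
  by apply/funext => y; exact: hess.
have u12 : E e2 (u e3) = fun y => (- 2^-1) * u e4 y + u e2 y * u e3 y.
  by rewrite uE; apply/funext => y; rewrite sum_ord4 /g_conn /=; ring.
have u21 : E e3 (u e2) = fun y => 2^-1 * u e4 y + u e2 y * u e3 y.
  by rewrite uE; apply/funext => y; rewrite sum_ord4 /g_conn /=; ring.
have u13 : E e2 (u e4) = fun y => 2^-1 * u e3 y + u e2 y * u e4 y.
  by rewrite uE; apply/funext => y; rewrite sum_ord4 /g_conn /=; ring.
have u31 : E e4 (u e2) = fun y => 2^-1 * u e3 y + u e2 y * u e4 y.
  by rewrite uE; apply/funext => y; rewrite sum_ord4 /g_conn /=; ring.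
have u23 : E e3 (u e4) = fun y => (- 2^-1) * u e2 y + u e3 y * u e4 y.
  by rewrite uE; apply/funext => y; rewrite sum_ord4 /g_conn /=; ring.
have u32 : E e4 (u e3) = fun y => (- 2^-1) * u e2 y + u e3 y * u e4 y.
  by rewrite uE; apply/funext => y; rewrite sum_ord4 /g_conn /=; ring.
have EuM a r p q s : E a (fun y => r * u p y + u q y * u s y) x =
    r * E a (u p) x + u q x * E a (u s) x + u s x * E a (u q) x.
  have sM := smoothM sE; have sc := smooth_cst sE.
  rewrite (frameD sE); [|exact: sM|exact: sM].
  rewrite !(frameM sE) ?(frame_cst sE)//.
  by ring.
have d2 : E e2 (u e2) x =
    - r1 * u e1 x + u e2 x ^+ 2 + 2^-1 * g_ricci r1 r2 e2 - psi x.
  by rewrite uE sum_ord4 /g_conn /=; ring.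
have d3 : E e3 (u e3) x =
    - r2 * u e1 x + u e3 x ^+ 2 + 2^-1 * g_ricci r1 r2 e3 - psi x.
  by rewrite uE sum_ord4 /g_conn /=; ring.
have d4 : E e4 (u e4) x =
    - (r1 + r2) * u e1 x + u e4 x ^+ 2 + 2^-1 * g_ricci r1 r2 e4 - psi x.
  by rewrite uE sum_ord4 /g_conn /=; ring.
(* After substitution the brackets say that X_2 + X_3 = 2 X_4 and X_2 = X_4,
   where X_i = E_i u_i - u_i ^+ 2. *)
have b1 := Ebr e2 e3 (su e4) x; have b2 := Ebr e2 e4 (su e3) x.
rewrite u23 u13 !EuM u12 u21 u23 u13 d2 d3 sum_ord4 in b1.
rewrite /g_struct /g_struct_half /g_ricci /= -/(u e4) d4 /g_ricci /= in b1.
rewrite u32 u12 !EuM u31 u32 u12 u13 d2 d4 sum_ord4 in b2.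
rewrite /g_struct /g_struct_half /g_ricci /= in b2.
(* X_2 = X_4 *)
have r2u : r2 * u e1 x = 2^-1 - r2 * (r1 + r2) by lra.
(* X_3 = X_4 *)
have r1u : r1 * u e1 x = 2^-1 - r1 * (r1 + r2) by lra.
have : r1 * (r2 * u e1 x) = r2 * (r1 * u e1 x) by ring.
rewrite r2u r1u => e; move/eqP: r12; apply.
by lra.
Qed.
End Obstruction.

(** * The metric is Bach-flat *)
Section BachWeyl.
Context {R : realType} {M : Type}.
Variables (S : set (M -> R)) (E : 'I_4 -> (M -> R) -> M -> R).
Hypothesis sE : smooth_frame S E.
Variables r1 r2 : R.
Local Notation c := (g_struct r1 r2).
Local Notation h := (@frame_metric R M).
Local Notation G := (g_conn r1 r2).
Local Notation rho := (g_ricci r1 r2).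
Hypothesis r12 : r1 * r2 = - 8^-1.
Hypothesis r12sq : r1 ^+ 2 + r2 ^+ 2 = 7 / 8.

Lemma christoffel_g_struct i j k x : christoffel E c h i j k x = G i j k.
Proof. by rewrite (christoffel_frame sE) levi_civita_conn_g_struct. Qed.

(** The covariant derivative of a diagonal tensor with constant eigenvalues only
    sees the differences of these eigenvalues. *)
Definition g_dricci (k i j : 'I_4) : R := G k i j * (rho i - rho j).

Lemma cov_deriv2_g_struct k i j x :
  cov_deriv2 E c h (ricci E c h) k i j x = g_dricci k i j.
Proof.
rewrite /cov_deriv2 (_ : ricci E c h i j = fun=> rho i * (i == j)%:R); last first.
  by apply/funext => y; exact: (ricci_g_struct sE).
rewrite (frame_cst sE).
under eq_bigr do rewrite christoffel_g_struct (ricci_g_struct sE) mulrA.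
under [X in _ - X]eq_bigr do
  rewrite christoffel_g_struct (ricci_g_struct sE) eq_sym mulrA.
rewrite !sum_deltar /g_dricci.
rewrite -levi_civita_conn_g_struct.
rewrite [levi_civita_conn _ k j i](levi_civita_connN (g_structN _ _)).
ring.
Qed.

Lemma cov2_ricci_g_struct p q i j x :
  cov2_ricci E c h p q i j x =
  - (\sum_l (G p q l * g_dricci l i j + G p i l * g_dricci q l j
             + G p j l * g_dricci q i l)).
Proof.
rewrite /cov2_ricci /cov_deriv3.
rewrite (_ : cov_deriv2 E c h (ricci E c h) q i j = fun=> g_dricci q i j); last first.
  by apply/funext => y; exact: cov_deriv2_g_struct.
rewrite (frame_cst sE) sub0r !big_split /= !opprD.
by congr (- _ - _ - _); apply: eq_bigr => l _;
  rewrite christoffel_g_struct cov_deriv2_g_struct.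
Qed.

Lemma scalar_curv_g_struct x : scalar_curv E c h x = rho e1 + rho e2 + rho e3 + rho e4.
Proof.
rewrite /scalar_curv frame_metricE invmx1 -sum_ord4.
apply: eq_bigr => i _; under eq_bigr do rewrite (ricci_g_struct sE) mxE mulrC -mulrA.
rewrite (bigD1 i)//= eqxx !mulr1 big1 ?addr0// => j /negPf.
by rewrite eq_sym => ->; rewrite !mulr0.
Qed.

(** Off the diagonal the components vanish identically in [r1] and [r2]. *)
Lemma bach_flat_g_struct : bach_flat E c.
Proof.
have f12 : r1 * r2 + 8^-1 = 0 by rewrite r12 addNr.
have fsq : r1 ^+ 2 + r2 ^+ 2 - 7 / 8 = 0 by rewrite r12sq subrr.
have idealP a b z : z = a * (r1 * r2 + 8^-1) + b * (r1 ^+ 2 + r2 ^+ 2 - 7 / 8) ->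
  z = 0 by rewrite f12 fsq !mulr0 addr0.
move=> i j x; rewrite /bach /= scalar_curv_g_struct.
rewrite !sum_ord4 !cov2_ricci_g_struct !(ricci_g_struct sE) !sum_ord4.
rewrite /g_dricci /g_conn /g_ricci.
elim/ord4_ind: i; elim/ord4_ind: j => /=.
all: try by field.
(* The cofactors are the quotients of the diagonal components in the division
   by the two relations. *)
- apply: (idealP (2 / 3 * r1 ^+ 2 - 2 / 3 * (r1 * r2) + 2 / 3 * r2 ^+ 2 - 5 / 12)
    (- 4^-1)).
  by field.
- apply: (idealP (2 / 3 * r1 ^+ 2 - 2 / 3 * (r1 * r2) - 2 * r2 ^+ 2 + 5 / 4)
    (3 / 4)).
  by field.
- apply: (idealP (- 2 * r1 ^+ 2 - 2 / 3 * (r1 * r2) + 2 / 3 * r2 ^+ 2 + 5 / 4)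
    (3 / 4)).
  by field.
- apply: (idealP (2 / 3 * r1 ^+ 2 + 2 * (r1 * r2) + 2 / 3 * r2 ^+ 2 - 25 / 12)
    (- (5 / 4))).
  by field.
Qed.

End BachWeyl.

(** * The metric is not half conformally flat *)
Section Symbol.
Context {R : realType}.

(** The matrix that defines the symbol is then a permutation matrix. *)
Lemma levi_civita_symbol_perm (s : 'S_4) :
  levi_civita_symbol (s e1) (s e2) (s e3) (s e4) = (-1) ^+ s :> R.
Proof.
rewrite -det_perm; congr (\det _); apply/matrixP => a b; rewrite !mxE.
by elim/ord4_ind: a; rewrite (tnth_nth e1).
Qed.

(** A repeated index gives two equal rows. *)
Lemma levi_civita_symbol_rep (i j k l a b : 'I_4) : a != b ->
  tnth [tuple i; j; k; l] a = tnth [tuple i; j; k; l] b ->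
  levi_civita_symbol i j k l = 0 :> R.
Proof.
move=> ab tab; apply: (determinant_alternate ab) => m.
by rewrite !mxE tab.
Qed.

Lemma levi_civita_symbol_sum14 (w : 'I_4 -> 'I_4 -> R) :
  \sum_a \sum_b levi_civita_symbol e1 e4 a b * w a b = w e2 e3 - w e3 e2.
Proof.
have e1423 : levi_civita_symbol e1 e4 e2 e3 = 1 :> R.
  have := levi_civita_symbol_perm (tperm e2 e3 * tperm e3 e4)%g.
  by rewrite !permM odd_permM !odd_tperm !permE /=.
have e1432 : levi_civita_symbol e1 e4 e3 e2 = -1 :> R.
  have := levi_civita_symbol_perm (tperm e2 e4).
  by rewrite odd_tperm !permE /=.
have rep3 b : levi_civita_symbol e1 e4 e1 b = 0 :> R.
  exact: (@levi_civita_symbol_rep _ _ _ _ e1 e3).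
have rep4 b : levi_civita_symbol e1 e4 e4 b = 0 :> R.
  exact: (@levi_civita_symbol_rep _ _ _ _ e2 e3).
have rep3' a : levi_civita_symbol e1 e4 a e1 = 0 :> R.
  exact: (@levi_civita_symbol_rep _ _ _ _ e1 e4).
have rep4' a : levi_civita_symbol e1 e4 a e4 = 0 :> R.
  exact: (@levi_civita_symbol_rep _ _ _ _ e2 e4).
have rep a : levi_civita_symbol e1 e4 a a = 0 :> R.
  exact: (@levi_civita_symbol_rep _ _ _ _ e3 e4).
rewrite !sum_ord4 !rep3 !rep4 !rep3' !rep4' !rep e1423 e1432.
by ring.
Qed.

End Symbol.

Section Weyl.
Context {R : realType} {M : Type}.
Variables (S : set (M -> R)) (E : 'I_4 -> (M -> R) -> M -> R).
Hypothesis sE : smooth_frame S E.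
Variables r1 r2 : R.
Local Notation c := (g_struct r1 r2).
Local Notation h := (@frame_metric R M).
Local Notation G := (g_conn r1 r2).
Local Notation rho := (g_ricci r1 r2).
Local Notation d i j := ((i == j)%:R : R).

Lemma riemann_g_struct i j k l x : riemann E c h i j k l x =
  \sum_m (G j k m * G i m l - G i k m * G j m l) - \sum_m c i j m * G m k l.
Proof.
rewrite /riemann frame_metricE.
under eq_bigr do rewrite [1%:M _ _]mxE.
by rewrite sum_deltar (curvature_frame sE) levi_civita_conn_g_struct.
Qed.

Lemma hodge_star_14 w x : hodge_star h w e1 e4 x = 2^-1 * (w e2 e3 x - w e3 e2 x).
Proof.
rewrite -(levi_civita_symbol_sum14 (fun a b => w a b x)) /hodge_star.
congr (_ * _); apply: eq_bigr => a _; apply: eq_bigr => b _.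
rewrite frame_metricE det1 sqrtr1 mul1r invmx1.
under eq_bigr => p _ do under eq_bigr => q _ do
  rewrite !mxE [b == q]eq_sym mulrAC.
under eq_bigr do rewrite sum_deltar eq_sym mulrAC.
by rewrite sum_deltar.
Qed.

(** The component that [hodge_star_14] relates to [weyl_2314]: [W_+] and [W_-]
    restricted to the indices 1414 are half of [W_1414 + W_2314] and of
    [W_1414 - W_2314]. *)
Lemma weyl_1414 x : r1 * r2 = - 8^-1 -> r1 ^+ 2 + r2 ^+ 2 = 7 / 8 ->
  weyl E c h e1 e4 e1 e4 x = 4^-1.
Proof.
move=> r12 r12sq.
rewrite /weyl riemann_g_struct !(ricci_g_struct sE) (scalar_curv_g_struct sE).
rewrite frame_metricE !mxE !sum_ord4.
rewrite /g_conn /g_struct /g_struct_half /g_ricci /=.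
lra.
Qed.

Lemma weyl_2314 x : weyl E c h e2 e3 e1 e4 x = 2^-1 * (r1 + r2) /\
  weyl E c h e3 e2 e1 e4 x = - (2^-1 * (r1 + r2)).
Proof.
rewrite /weyl !riemann_g_struct !(ricci_g_struct sE) (scalar_curv_g_struct sE).
rewrite frame_metricE !mxE !sum_ord4.
rewrite /g_conn /g_struct /g_struct_half /g_ricci /=.
by split; field.
Qed.

Lemma not_half_conformally_flat_g_struct (x : M) :
  r1 * r2 = - 8^-1 -> r1 ^+ 2 + r2 ^+ 2 = 7 / 8 ->
  ~ half_conformally_flat E c h.
Proof.
move=> r12 r12sq; have ssq : (r1 + r2) ^+ 2 = 5 / 8 by lra.
have [w23 w32] := weyl_2314 x; have w14 := weyl_1414 x r12 r12sq.
case=> /(_ e1 e4 e1 e4 x).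
  rewrite /weyl_plus hodge_star_14 w14 w23 w32 => w0.
  have s : r1 + r2 = - 2^-1 by lra.
  by move: ssq; rewrite s; lra.
rewrite /weyl_minus hodge_star_14 w14 w23 w32 => w0.
have s : r1 + r2 = 2^-1 by lra.
by move: ssq; rewrite s; lra.
Qed.
End Weyl.

(** * The theorem *)
Lemma smooth_frame_vector_fields {R : realType} {n : nat} {M : topologicalType}
    (A : set (chart (R := R) n M)) (E : 'I_n -> (M -> R) -> M -> R) :
  (forall p : M, exists2 a, A a & chart_dom a p) ->
  (forall i, vector_field A (E i)) -> smooth_frame (smooth_fun A) E.
Proof.
move=> coverA vE; split.
- exact: smooth_fun_cst.
- exact: smooth_funD.
- exact: smooth_funM.
- exact: smooth_fun_expR.
- by move=> i f; exact: (vE i).1.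
- by move=> i r x; exact: (vector_field_cst coverA (vE i)).
- by move=> i f g x; exact: (vector_fieldD coverA (vE i)).
- by move=> i f g x; exact: (vector_fieldM coverA (vE i)).
- by move=> i f x; exact: (vector_field_expR coverA (vE i)).
Qed.

(** Denesting: 7 - 3 s sqrt 5 is the square of (sqrt 2 / 2) (3 - s sqrt 5) for
    either sign [s], and the latter is nonnegative because 5 <= 9. *)
Lemma sqrt_denest (R : realType) (sg : R) : sg ^+ 2 = 1 ->
  Num.sqrt (7 - sg * 3 * Num.sqrt 5) = 2^-1 * (3 * Num.sqrt 2 - sg * Num.sqrt 10).
Proof.
move=> sg2.
have -> : Num.sqrt 10 = Num.sqrt 2 * Num.sqrt 5 :> R.
  by rewrite -sqrtrM ?ler0n// -natrM.
have s2 : Num.sqrt 2 ^+ 2 = 2 :> R by rewrite sqr_sqrtr ?ler0n.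
have s5 : Num.sqrt 5 ^+ 2 = 5 :> R by rewrite sqr_sqrtr ?ler0n.
have p2 : 0 <= Num.sqrt 2 :> R := sqrtr_ge0 _.
set a := Num.sqrt 2 in s2 p2 *; set b := Num.sqrt 5 in s5 *.
have -> : 7 - sg * 3 * b = (2^-1 * a * (3 - sg * b)) ^+ 2.
  by rewrite !exprMn s2 sqrrB exprMn s5 sg2; field.
have sgb : sg * b <= 3.
  have : (sg * b) ^+ 2 <= 3 ^+ 2 by rewrite exprMn s5 sg2; lra.
  rewrite -ler_sqrt ?exprn_ge0// !sqrtr_sqr (ger0_norm (ler0n _ 3)).
  exact/le_trans/ler_norm.
rewrite sqrtr_sqr ger0_norm; first by field.
by rewrite !mulr_ge0 ?subr_ge0// invr_ge0 ler0n.
Qed.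

Theorem theorem3p1 (R : realType) (r1 r2 : R)
    (hr1 : r1 = 4^-1 * Num.sqrt (7 - 3 * Num.sqrt 5))
    (hr2 : r2 = - (4^-1 * Num.sqrt (7 + 3 * Num.sqrt 5)))
    (G : topGroupType) (A : set (chart (R := R) 4 G))
    (hG : is_lie_group A)
    (hsc : simply_connected (R := R) G)
    (E : 'I_4 -> (G -> R) -> G -> R)
    (hE : lie_algebra_basis A E)
    (hbr : structure_constants A E (g_struct r1 r2)) :
  [/\ r1 = 8^-1 * (3 * Num.sqrt 2 - Num.sqrt 10),
      r2 = - (8^-1 * (3 * Num.sqrt 2 + Num.sqrt 10)) &
      nontrivially_bach_flat A E (g_struct r1 r2)].
Proof.
have r1E : r1 = 8^-1 * (3 * Num.sqrt 2 - Num.sqrt 10).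
  have := sqrt_denest (expr1n R 2); rewrite !mul1r hr1 => ->.
  by field.
have r2E : r2 = - (8^-1 * (3 * Num.sqrt 2 + Num.sqrt 10)).
  have := @sqrt_denest R (-1); rewrite sqrrN expr1n => /(_ erefl).
  by rewrite !mulN1r !mulNr !opprK hr2 => ->; field.
have s2 : Num.sqrt 2 ^+ 2 = 2 :> R by rewrite sqr_sqrtr ?ler0n.
have s10 : Num.sqrt 10 ^+ 2 = 10 :> R by rewrite sqr_sqrtr ?ler0n.
have r12 : r1 * r2 = - 8^-1 by rewrite r1E r2E; lra.
have r12sq : r1 ^+ 2 + r2 ^+ 2 = 7 / 8 by rewrite r1E r2E; lra.
(* otherwise the negative number - 1/8 would be a square *)
have r1_neq_r2 : r1 != r2.
  by apply/eqP => r12E; have := sqr_ge0 r2; move: r12; rewrite r12E -expr2 => ->; lra.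
have sE : smooth_frame (smooth_fun A) E.
  apply: smooth_frame_vector_fields; first by case: hG => -[].
  by move=> i; exact: (hE.1 i).1.
split=> //; split.
- exact: (bach_flat_g_struct sE r12 r12sq).
- case=> f sf; exact: (not_conformally_einstein_g_struct sE hbr (1%g : G) r1_neq_r2 sf).
- exact: (not_half_conformally_flat_g_struct sE (1%g : G) r12 r12sq).
Qed.
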